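(* Let $t\ge 2$ and let $G$ be a $\frac{3t-1}{2}$-tough graph. Then $G$ is Hamiltonian if and only if its $t$-closure $G^{*t}$ is Hamiltonian.
   Context: Graphs are finite and simple and have at least three vertices. A subset $C$ of vertices of a graph $G=(V,E)$ is a cut-set if the induced subgraph $G[V\setminus C]$ is disconnected ($C=\emptyset$ is allowed when $G$ itself is disconnected). For a real number $s$, $G$ is $s$-tough if for every cut-set $C$ of $G$, $s\cdot c(G[V\setminus C])\le |C|$, where $c(H)$ denotes the number of connected components of $H$. A graph is Hamiltonian if it contains a cycle (not necessarily induced) through all of its vertices. The $t$-closure of an $n$-vertex graph $G$ is the graph $G^{*t}$ obtained as follows: (i) start with $G^{*t}=G$; (ii) find two distinct non-adjacent vertices $x,y$ of the current graph $G^{*t}$ such that $d_{G^{*t}}(x)+d_{G^{*t}}(y)\ge n-t$, and add the edge $xy$ to $G^{*t}$; (iii) repeat step (ii) until no such pair $x,y$ is present in $G^{*t}$. Here $d_H(v)$ is the degree of $v$ in $H$. The resulting graph does not depend on the order in which edges are added. *)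

(* Defs.v *)
From mathcomp Require Import all_boot all_order all_algebra.
From mathcomp Require Import reals.

Set Implicit Arguments.
Unset Strict Implicit.
Unset Printing Implicit Defensive.

Import Order.TTheory GRing.Theory Num.Theory.

Local Open Scope ring_scope.

Record sgraph (T : finType) := SGraph {
  adj :> rel T;
  adj_sym : symmetric adj;
  adj_irr : irreflexive adj
}.

Section Graphs.
Variable T : finType.
Implicit Types G H F : sgraph T.

Definition deg G (x : T) : nat := #|[set y | G x y]|.

Definition disconnected G : Prop := exists x y : T, ~~ connect G x y.

Definition ncomp G : nat := n_comp G [pred x : T | true].

Definition hamiltonian G : Prop :=
  exists c : seq T, [/\ (3 <= size c)%N, ucycle G c & forall x, x \in c].

Lemma induced_sym G (A : {set T}) :
  symmetric (fun u v : {x | x \in A} => G (val u) (val v)).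
Proof. by move=> u v; rewrite adj_sym. Qed.

Lemma induced_irr G (A : {set T}) :
  irreflexive (fun u v : {x | x \in A} => G (val u) (val v)).
Proof. by move=> u; rewrite adj_irr. Qed.

Definition induced G (A : {set T}) : sgraph {x | x \in A} :=
  SGraph (@induced_sym G A) (@induced_irr G A).

Definition add_edge_rel G (x y : T) : rel T :=
  fun u v => [|| G u v, (u == x) && (v == y) | (u == y) && (v == x)].

Lemma add_edge_sym G x y : symmetric (add_edge_rel G x y).
Proof.
by move=> u v; rewrite /add_edge_rel adj_sym [(v == x) && _]andbC
  [(v == y) && _]andbC [X in _ || X]orbC.
Qed.

Lemma add_edge_irr G x y : x != y -> irreflexive (add_edge_rel G x y).
Proof.
move=> xy u; rewrite /add_edge_rel adj_irr /=.
by case: (eqVneq u x) xy => [->|_] /negbTE xy; rewrite ?xy //= andbF.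
Qed.

Definition add_edge G (x y : T) (xy : x != y) : sgraph T :=
  SGraph (@add_edge_sym G x y) (@add_edge_irr G x y xy).

End Graphs.

Definition cutset (T : finType) (G : sgraph T) (C : {set T}) : Prop :=
  disconnected (induced G (~: C)).

Section Toughness.
Variables (R : realType) (T : finType).
Implicit Types (G H F : sgraph T) (s t : R).

Definition tough s G : Prop :=
  forall C : {set T}, cutset G C ->
    s * (ncomp (induced G (~: C)))%:R <= #|C|%:R.

Definition addable t G (x y : T) : Prop :=
  [/\ x != y, ~~ G x y & #|T|%:R - t <= (deg G x + deg G y)%:R].

(* [is_tclosure t G Gs]: some exhaustive run of the edge-adding procedure
   started at [G] ends with [Gs]. Such a run exists ([tclosure_exists]) and its
   result does not depend on the choices made ([tclosure_unique]). *)
Inductive is_tclosure t : sgraph T -> sgraph T -> Prop :=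
| TClosureStop G :
    (forall x y, ~ addable t G x y) -> is_tclosure t G G
| TClosureAdd G Gs x y (xy : x != y) :
    addable t G x y -> is_tclosure t (add_edge G xy) Gs -> is_tclosure t G Gs.

Lemma leq_deg G H x : subrel G H -> (deg G x <= deg H x)%N.
Proof. by move=> GH; apply/subset_leq_card/subsetP=> y; rewrite !inE; apply: GH. Qed.

Lemma tclosure_exists t G : exists Gs, is_tclosure t G Gs.
Proof.
pose ne G := #|[set p : T * T | ~~ G p.1 p.2]|.
have [n] := ubnP (ne G); elim: n G => // n IHn G ltGn.
pose ok (p : T * T) := [&& p.1 != p.2, ~~ G p.1 p.2 &
  #|T|%:R - t <= (deg G p.1 + deg G p.2)%:R].
case: (pickP ok) => [[x y] /and3P[/= xy nGxy dxy]|no_ok]; last first.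
  exists G; apply: TClosureStop => x y [xy nGxy dxy].
  by have := no_ok (x, y); rewrite /ok /= xy nGxy dxy.
have [|Gs cGs] := IHn (add_edge G xy); last first.
  by exists Gs; apply: TClosureAdd cGs.
rewrite -ltnS; apply: leq_trans ltGn; rewrite ltnS; apply/proper_card/properP.
split; first by apply/subsetP=> p; rewrite !inE negb_or => /andP[].
by exists (x, y); rewrite !inE //= /add_edge_rel !eqxx orbT.
Qed.

Lemma tclosure_sup t G Gs : is_tclosure t G Gs -> subrel G Gs.
Proof.
elim=> [{}G _ u v //|{}G {}Gs x y xy _ _ sub u v Guv]; apply: sub.
by rewrite /= /add_edge_rel Guv.
Qed.

Lemma tclosure_stop t G Gs :
  is_tclosure t G Gs -> forall x y, ~ addable t Gs x y.
Proof. by elim. Qed.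

Lemma tclosure_min t G Gs F :
    is_tclosure t G Gs -> (forall x y, ~ addable t F x y) ->
  subrel G F -> subrel Gs F.
Proof.
move=> cG Fstop; elim: cG => // {}G {}Gs x y xy [_ _ dxy] _ IH GF.
have Fxy : F x y.
  apply: contraPT (Fstop x y) => nFxy; apply; split=> //.
  by apply: le_trans dxy _; rewrite ler_nat leq_add ?leq_deg.
apply: IH => u v /or3P[/GF //||] /andP[/eqP-> /eqP->] //.
by rewrite adj_sym.
Qed.

Lemma tclosure_unique t G Gs Gs' :
  is_tclosure t G Gs -> is_tclosure t G Gs' -> Gs =2 Gs'.
Proof.
move=> c c' x y; apply/idP/idP.
  by apply: (tclosure_min c (tclosure_stop c') (tclosure_sup c')).
by apply: (tclosure_min c' (tclosure_stop c) (tclosure_sup c)).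
Qed.

End Toughness.

(* Main.v *)
(* Toughness passes to supergraphs, so it suffices to undo one edge xy of the
   closure. If G has no Hamiltonian cycle, a Hamiltonian cycle of G + xy yields
   a Hamiltonian path v_0 = x, ..., v_m = y of G. No index i has both x ~ v_{i+1}
   and y ~ v_i, so by the degree condition the number k of indices i < m with
   neither ("gaps") is at most t - 1. Call v_j a pivot if y ~ v_{j-1} and
   x ~ v_{j+1}, and let p be the number of pivots.

   If p = 0, the predecessors X of the neighbours of x and the successors Y of
   the neighbours of y are disjoint and miss k + 1 vertices. Rerouting the path
   shows that an edge between X and Y must come from one of at most 2k vertices
   of Y, each charged to a gap. Deleting these and the missed vertices separates
   x from y by at most 3k + 1 < 3t - 1 vertices.

   If p > 0, the pivots are pairwise non-adjacent and not adjacent to x. Up to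
   gap-related exceptions, the neighbours of a pivot are path-neighbours of
   pivots, so a pivot has degree at most p + 1 + k, while toughness forces
   degree at least 3t - 1. Hence p >= 2t - 1. Isolating all pivots from x at once
   costs at most 2p + 4k vertices, which contradicts toughness except when t = 2
   and p = 3; there one exceptional neighbour can be saved. *)

Require Import Defs.
From mathcomp Require Import all_boot all_order all_algebra.
From mathcomp Require Import boolp reals zify lra.

Set Implicit Arguments.
Unset Strict Implicit.

Import Order.TTheory GRing.Theory Num.Theory.
Local Open Scope ring_scope.

(** * Counting the indices 0, ..., m *)

Section Count.
Local Open Scope nat_scope.
Variable m : nat.
Implicit Types P Q : pred nat.

Definition cnt P : nat := \sum_(0 <= i < m.+1) P i.

Lemma cnt_sub P Q : (forall i, i <= m -> P i -> Q i) -> cnt P <= cnt Q.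
Proof.
move=> PQ; rewrite /cnt !big_nat; apply: leq_sum => i.
by case: (P i) (PQ i) => //= /(_ _ isT) H Hi; rewrite H //; lia.
Qed.

Lemma cntUI P Q :
  cnt (fun i => P i || Q i) + cnt (fun i => P i && Q i) = cnt P + cnt Q.
Proof.
rewrite /cnt -!big_split; apply: eq_bigr => i _ /=.
by case: (P i); case: (Q i).
Qed.

Lemma cntU_le P Q : cnt (fun i => P i || Q i) <= cnt P + cnt Q.
Proof. by rewrite -cntUI leq_addr. Qed.

Lemma cntU P Q : (forall i, i <= m -> ~~ (P i && Q i)) ->
  cnt (fun i => P i || Q i) = cnt P + cnt Q.
Proof.
move=> dPQ; rewrite -cntUI [X in _ + X]big_nat big1 ?addn0 // => i.
by rewrite andTb ltnS => /dPQ/negbTE->.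
Qed.

(** The shift drops index 0 and brings in index m + 1, where [P] must therefore fail. *)
Lemma cnt_succ P : ~~ P m.+1 -> cnt (fun i => P i.+1) <= cnt P.
Proof.
move=> nP; rewrite /cnt [leqRHS]big_nat_recl // big_nat_recr //=.
by rewrite (negbTE nP) addn0 leq_addl.
Qed.

Lemma cnt_pred P : cnt (fun i => (0 < i) && P i.-1) <= cnt P.
Proof.
by rewrite /cnt big_nat_recl //= [leqRHS]big_nat_recr //= add0n leq_addr.
Qed.

Lemma cnt_ltn k : k <= m.+1 -> cnt (fun i => i < k) = k.
Proof.
move=> km; rewrite /cnt (big_cat_nat _ km) //= big_nat.
rewrite (eq_bigr (fun=> 1)) => [|i /andP[_ ->] //].
rewrite -big_nat sum_nat_const_nat subn0 muln1 big_nat big1 ?addn0 //.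
by move=> i /andP[ki _]; rewrite ltnNge ki.
Qed.

Lemma cnt1 j : j <= m -> cnt (fun i => i == j) = 1.
Proof.
move=> jm; have : cnt (fun i => (i < j) || (i == j)) = cnt (fun i => i < j.+1).
  by apply: eq_bigr => i _; congr nat_of_bool; lia.
rewrite cntU => [|i _]; last by lia.
by rewrite !cnt_ltn; lia.
Qed.

Lemma cnt_gt0 P : 0 < cnt P -> exists2 i, i <= m & P i.
Proof.
have [/hasP[i]|/hasPn nP] := boolP (has P (index_iota 0 m.+1)).
  by rewrite mem_index_iota ltnS; exists i.
by rewrite /cnt big_seq big1 // => i /nP/negbTE->.
Qed.

Lemma cnt_uniq P s : uniq s -> (forall i, i \in s -> (i <= m) && P i) ->
  size s <= cnt P.
Proof.
move=> us sP; have -> : cnt P = size (filter P (index_iota 0 m.+1)).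
  by rewrite size_filter -sum1_count big_mkcond; apply: eq_bigr => i _; case: (P i).
apply: uniq_leq_size => // i /sP /andP[im Pi].
by rewrite mem_filter Pi mem_index_iota ltnS.
Qed.

End Count.

(* Toughness with a lower bound on the number of components given by a set I of
   vertices separated by a colouring f that is constant on the edges avoiding C:
   no component has to be counted, and the property is monotone in the edges. *)
Definition colour_tough (R : realType) (m : nat) (e : rel nat) (s : R) :=
  forall (C I : pred nat) (f : nat -> option nat),
    (forall i, (i <= m)%N -> I i -> ~~ C i) ->
    (forall i j, ~~ C i -> ~~ C j -> e i j -> f i = f j) ->
    (forall i j, (i <= m)%N -> (j <= m)%N -> I i -> I j -> f i = f j -> i = j) ->
    (2 <= cnt m I)%N ->
  s * (cnt m I)%:R <= (cnt m C)%:R.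

(** * Paths with visible ends *)

Section Segments.
Local Open Scope nat_scope.
Variable e : rel nat.
Hypothesis e_sym : symmetric e.

(** Both ends are recorded so that a rerouted cycle can be checked by gluing and reversing
    intervals. *)
Definition seg (l : seq nat) (h t : nat) : bool :=
  if l is x :: p then [&& path e x p, x == h & last x p == t] else false.

Lemma seg_cat l1 l2 h1 t1 h2 t2 :
  seg l1 h1 t1 -> seg l2 h2 t2 -> e t1 h2 -> seg (l1 ++ l2) h1 t2.
Proof.
case: l1 l2 => [|x p] [|y q] //= /and3P[xp -> /eqP<-] /and3P[yq /eqP<- lq] exy.
by rewrite cat_path last_cat xp /= exy yq lq.
Qed.

Lemma seg_rev l h t : seg l h t -> seg (rev l) t h.
Proof.
case/lastP: l => [//|p z]; rewrite rev_rcons /=.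
case: p => [|x p] /=; first by move=> /andP[/eqP-> /eqP->]; rewrite !eqxx.
rewrite rcons_path last_rcons => /and3P[/andP[xp ez] /eqP<- ->].
have := rev_path e x (rcons p z); rewrite last_rcons belast_rcons => H.
rewrite rev_cons last_rcons eqxx andbT.
rewrite -rev_cons H rcons_path.
rewrite (eq_path (e' := e)) => [|u v]; last by rewrite e_sym.
by rewrite xp e_sym ez.
Qed.

Lemma seg_cycle l h t : seg l h t -> e t h -> cycle e l.
Proof.
by case: l => //= x p /and3P[xp /eqP<- /eqP<-] eth; rewrite rcons_path xp.
Qed.

Lemma seg_iota a k : (forall i, a <= i < a + k -> e i i.+1) ->
  seg (iota a k.+1) a (a + k).
Proof.
elim: k a => [|k IHk] a He /=; first by rewrite addn0 !eqxx.
have /= := IHk a.+1; rewrite eqxx addSnnS /= => IH.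
rewrite He ?eqxx /= ?IH //; last by lia.
by move=> i Hi; apply: He; lia.
Qed.

End Segments.

(** * Chords excluded by rerouting the path *)

(* The Hamiltonian path is 0, 1, ..., m, so that x = 0 and y = m. *)
Section Crossings.
Local Open Scope nat_scope.
Variables (m : nat) (e : rel nat).
Hypotheses (e_sym : symmetric e) (e_irr : irreflexive e).
Hypotheses (e_dom : forall i j, e i j -> i <= m).
Hypothesis e_succ : forall i, i < m -> e i i.+1.
Hypothesis no_ham : forall l, size l = m.+1 -> (forall i, i <= m -> i \in l) ->
  ~~ cycle e l.

Let up a b := iota a (b - a).+1.
Let dn a b := rev (up b a).

Lemma seg_up a b : a <= b <= m -> seg e (up a b) a b.
Proof.
move=> abm; have {2}-> : b = a + (b - a) by lia.
by apply: seg_iota => i Hi; apply: e_succ; lia.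
Qed.

Lemma seg_dn a b : b <= a <= m -> seg e (dn a b) a b.
Proof. by move=> H; apply: seg_rev => //; apply: seg_up. Qed.

Lemma no_seg l h t : seg e l h t -> e t h -> size l = m.+1 ->
  (forall i, i <= m -> i \in l) -> False.
Proof. by move=> sl th /no_ham H /H; rewrite (seg_cycle sl). Qed.

Let segE := (size_cat, size_rev, size_iota).
Let memE := (mem_cat, mem_rev, mem_iota).

Ltac spanning :=
  rewrite /dn /up; first [rewrite !segE; lia | move=> ? ?; rewrite !memE; lia].

Lemma not_ends : ~~ e 0 m.
Proof.
apply/negP; rewrite e_sym => h.
have S1 : seg e (up 0 m) 0 m by apply: seg_up; lia.
by apply: (no_seg S1 h); spanning.
Qed.

Lemma x_range i : e 0 i.+1 -> i.+1 < m.
Proof.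
move=> h; have := not_ends; have := e_dom (i := i.+1) (j := 0).
rewrite e_sym h => /(_ isT); rewrite leq_eqVlt => /orP[/eqP <-|//].
by rewrite h.
Qed.

Lemma y_range i : e m i -> 0 < i < m.
Proof.
move=> h; have := not_ends; have := e_dom (i := i) (j := m).
rewrite e_sym h => /(_ isT) im n0m; case: (posnP i) => [i0|_].
  by move: n0m; rewrite e_sym -i0 h.
by move: im; rewrite leq_eqVlt => /orP[/eqP E|//]; rewrite E e_irr in h.
Qed.

(** Otherwise 0, ..., i, m, ..., i+1 is a Hamiltonian cycle. *)
Lemma not_succ i : e 0 i.+1 -> ~~ e m i.
Proof.
move=> xi; have := x_range xi => im; apply/negP=> yi.
have S1 : seg e (up 0 i) 0 i by apply: seg_up; lia.
have S2 : seg e (dn m i.+1) m i.+1 by apply: seg_dn; lia.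
have iy : e i m by rewrite e_sym.
have ix : e i.+1 0 by rewrite e_sym.
by apply: (no_seg (seg_cat S1 S2 iy) ix); spanning.
Qed.

(** The edge would close the cycle 0, ..., i, j, ..., m, j-1, ..., i+1. *)
Lemma XY_nonadj i j : i < j -> e 0 i.+1 -> e m j.-1 -> ~~ e i j.
Proof.
move=> ij xi yj; have := x_range xi; have := y_range yj => jm im.
(* For i = j-1 the last interval would be empty. *)
case: (eqVneq i j.-1) => [E|ne]; first by have := not_succ xi; rewrite E yj.
apply/negP=> h.
have S1 : seg e (up 0 i) 0 i by apply: seg_up; lia.
have S2 : seg e (dn j.-1 i.+1) j.-1 i.+1 by apply: seg_dn; lia.
have S3 : seg e (up j m) j m by apply: seg_up; lia.
have ix : e i.+1 0 by rewrite e_sym.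
by apply: (no_seg (seg_cat S1 (seg_cat S3 S2 yj) h) ix); spanning.
Qed.

(** The edge would close the cycle 0, ..., u, d, ..., u+1, m, ..., d+1. *)
Lemma YX_nonadj u d : u < d -> e m u.+1 -> e 0 d.+1 -> ~~ e u d.
Proof.
move=> ud yu xd; have := x_range xd => dm; apply/negP=> h.
have S1 : seg e (up 0 u) 0 u by apply: seg_up; lia.
have S2 : seg e (dn d u.+1) d u.+1 by apply: seg_dn; lia.
have S3 : seg e (dn m d.+1) m d.+1 by apply: seg_dn; lia.
have ix : e d.+1 0 by rewrite e_sym.
have uy : e u.+1 m by rewrite e_sym.
by apply: (no_seg (seg_cat S1 (seg_cat S2 S3 uy) h) ix); spanning.
Qed.

(** Mirror image of [YX_nonadj] under reversal of the path, with the cycle 0, ..., u-1, m, ..., d,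
    u, ..., d-1. *)
Lemma YX_nonadj' u d : 0 < u < d -> e m u.-1 -> e 0 d.-1 -> ~~ e u d.
Proof.
move=> ud yu xd; apply/negP=> h; have hd : e d u by rewrite e_sym.
have dm := e_dom hd.
have S1 : seg e (up 0 u.-1) 0 u.-1 by apply: seg_up; lia.
have S2 : seg e (up u d.-1) u d.-1 by apply: seg_up; lia.
have S3 : seg e (dn m d) m d by apply: seg_dn; lia.
have ix : e d.-1 0 by rewrite e_sym.
have uy : e u.-1 m by rewrite e_sym.
by apply: (no_seg (seg_cat S1 (seg_cat S3 S2 hd) uy) ix); spanning.
Qed.

Definition pivot j := [&& 0 < j, e 0 j.+1 & e m j.-1].

(** Without w the path closes up to the cycle 0, ..., w-1, m, ..., w+1; if w were adjacent to both c
    and c+1, it could be inserted between them. *)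
Lemma pivot_right w c : pivot w -> w < c -> e w c -> ~~ e w c.+1.
Proof.
move=> /and3P[w0 xw yw] wc h; apply/negP=> h'.
have h1 : e c.+1 w by rewrite e_sym.
have cm := e_dom h1.
have S0 : seg e (up w w) w w by apply: seg_up; lia.
have S1 : seg e (up 0 w.-1) 0 w.-1 by apply: seg_up; lia.
have S2 : seg e (dn c w.+1) c w.+1 by apply: seg_dn; lia.
have S3 : seg e (dn m c.+1) m c.+1 by apply: seg_dn; lia.
have ix : e w.+1 0 by rewrite e_sym.
have wy : e w.-1 m by rewrite e_sym.
by apply: (no_seg (seg_cat S0 (seg_cat S2 (seg_cat S1 S3 wy) ix) h) h1); spanning.
Qed.

Lemma pivot_left w c : pivot w -> c.+1 < w -> e w c -> ~~ e w c.+1.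
Proof.
move=> /and3P[w0 xw yw] wc h; apply/negP=> h'.
have h1 : e c.+1 w by rewrite e_sym.
have wm := x_range xw.
have S0 : seg e (up w w) w w by apply: seg_up; lia.
have S1 : seg e (dn c 0) c 0 by apply: seg_dn; lia.
have S2 : seg e (dn w.-1 c.+1) w.-1 c.+1 by apply: seg_dn; lia.
have S3 : seg e (up w.+1 m) w.+1 m by apply: seg_up; lia.
by apply: (no_seg (seg_cat S0 (seg_cat S1 (seg_cat S3 S2 yw) xw) h) h1); spanning.
Qed.

(** * Gaps, and the neighbours of one pivot *)

Definition gap i := [&& i < m, ~~ e 0 i.+1 & ~~ e m i].

Lemma pivot_range j : pivot j -> 0 < j /\ j.+1 < m.
Proof. by move=> /and3P[j0 /x_range]. Qed.

Lemma gap_pivot i : gap i -> ~~ pivot i && ~~ pivot i.+1.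
Proof.
by move=> /and3P[_ xi yi]; rewrite /pivot (negbTE xi) /= (negbTE yi) !andbF.
Qed.

(** The edge wc forbids both ends of the path to be adjacent to c-1. If c-1 is not a pivot, then 0
    misses c, which makes c-1 a gap, or m misses c-2, which makes c-2 a gap. *)
Lemma nbr_right w c : pivot w -> w.+1 < c -> e w c ->
  [|| pivot c.-1, gap c.-1 | gap c.-2].
Proof.
move=> pw wc h; have [w0 _] := pivot_range pw.
have [_ xw yw] := and3P pw.
have cm : c <= m by apply: (e_dom (j := w)); rewrite e_sym.
have nx : ~~ e 0 c.-1.
  by apply: contraL h => h'; apply: YX_nonadj' => //; lia.
have ny : ~~ e m c.-1.
  by apply: contraL h => h'; apply: XY_nonadj => //; lia.
by rewrite /pivot /gap !prednK ?nx ?ny; lia.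
Qed.

Lemma nbr_left w c : pivot w -> c.+1 < w -> e w c ->
  [|| pivot c.+1, gap c.+1 | gap c].
Proof.
move=> pw wc; rewrite e_sym => h; have [w0 wm] := pivot_range pw.
have [_ xw yw] := and3P pw.
have nx : ~~ e 0 c.+1.
  by apply: contraL h => h'; apply: XY_nonadj => //; lia.
have ny : ~~ e m c.+1.
  by apply: contraL h => h'; apply: YX_nonadj => //; lia.
by rewrite /pivot /gap /= nx ny; lia.
Qed.

Local Notation cnt := (cnt m).
Local Notation k := (cnt gap).
Local Notation p := (cnt pivot).

Lemma cnt_gap_succ (Q : pred nat) : (forall i, Q i -> gap i) ->
  cnt (fun i => Q i.+1) <= cnt Q.
Proof.
by move=> Qg; apply: cnt_succ; apply/negP => /Qg/and3P[]; lia.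
Qed.

Lemma cnt_pred2 (Q : pred nat) : cnt (fun i => (1 < i) && Q i.-2) <= cnt Q.
Proof.
apply: leq_trans (cnt_pred m Q).
apply: leq_trans (cnt_pred m (fun i => (0 < i) && Q i.-1)).
by apply: cnt_sub => i _ /andP[i1 ->]; lia.
Qed.

(** Besides w-1 and w+1, each neighbour of w is charged to another pivot or to a gap. A pivot is
    charged only from its side away from w, and a gap at most once, so the total is (p - 1) + 2 +
    k. *)
Lemma pivot_degree w : pivot w -> cnt (e w) <= p + 1 + k.
Proof.
move=> pw; have [w0 wm] := pivot_range pw.
pose R c := e w c && (w.+1 < c); pose L c := e w c && (c.+1 < w).
pose p1 i := (w < i) && pivot i; pose p2 i := (i < w) && pivot i.
pose g1 i := gap i && R i.+1; pose g2 i := gap i && R i.+2.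
pose g3 i := [&& gap i, 0 < i & L i.-1]; pose g4 i := gap i && L i.
(* Lower-case predicates are indexed by the charged pivot or gap, upper-case ones by the neighbour
   of [w]. *)
pose P1 i := (0 < i) && p1 i.-1; pose P2 i := p2 i.+1.
pose G1 i := (0 < i) && g1 i.-1; pose G2 i := (1 < i) && g2 i.-2.
pose G3 i := g3 i.+1.
have le1 : cnt P1 <= cnt p1 by apply: cnt_pred.
have le2 : cnt P2 <= cnt p2.
  by apply: cnt_succ; apply/negP=> /andP[_ /pivot_range]; lia.
have le3 : cnt G1 <= cnt g1 by apply: cnt_pred.
have le4 : cnt G2 <= cnt g2 by apply: cnt_pred2.
have le5 : cnt G3 <= cnt g3 by apply: cnt_gap_succ => i /and3P[].
have pivots : cnt p1 + cnt p2 + 1 <= p.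
  have <- : cnt (fun i => i == w) = 1 by apply: cnt1; lia.
  rewrite -cntU => [|i _]; last by rewrite /p1 /p2; case: ltngtP; rewrite ?andbF.
  rewrite -cntU => [|i _]; last by rewrite /p1 /p2; case: ltngtP; rewrite ?andbF.
  by apply: cnt_sub => i _ /orP[/orP[]/andP[]//|/eqP->].
(* Two of these events at the same i would give consecutive neighbours of w. *)
have gaps : cnt g1 + cnt g2 + (cnt g3 + cnt g4) <= k.
  rewrite -cntU => [|i _]; last first.
    apply/negP=> /andP[/andP[_ /andP[h1 l1]] /andP[_ /andP[h2 l2]]].
    by have := pivot_right pw _ h1; rewrite h2 => H; apply: notF; apply: H; lia.
  rewrite -cntU => [|i _]; last first.
    apply/negP=> /andP[/and3P[_ i0 /andP[h1 l1]] /andP[_ /andP[h2 l2]]].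
    have := pivot_left pw _ h1; rewrite prednK // h2 => H.
    by apply: notF; apply: H; lia.
  rewrite -cntU => [|i _]; last by rewrite /g1 /g2 /g3 /g4 /R /L; lia.
  by apply: cnt_sub => i _; rewrite /g1 /g2 /g3 /g4; case: (gap i).
have cover : cnt (e w) <= cnt (fun i => i == w.+1) + cnt (fun i => i == w.-1)
    + (cnt P1 + cnt P2) + (cnt G1 + cnt G2 + (cnt G3 + cnt g4)).
  have U := cntU_le m.
  apply: leq_trans (leq_add (leq_add (U _ _) (U _ _))
    (leq_add (U _ _) (U _ _))).
  apply: leq_trans (leq_add (U _ _) (U _ _)).
  apply: leq_trans (U _ _).
  apply: cnt_sub => c _ h.
  have cw : c != w by apply: contraTneq h => ->; rewrite e_irr.
  case: (ltngtP c w) cw => // cw _.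
    have [c1|c1] := leqP w c.+1.
      have -> : c == w.-1 by lia.
    by rewrite ?orbT.
    have Lc : L c by rewrite /L h.
    case/or3P: (nbr_left pw c1 h) => H.
    - have -> : P2 c by rewrite /P2 /p2 H c1.
    by rewrite ?orbT.
    - have -> : G3 c by rewrite /G3 /g3 H /= Lc.
    by rewrite ?orbT.
    - have -> : g4 c by rewrite /g4 H Lc.
    by rewrite ?orbT.
  have [c1|c1] := leqP c w.+1.
    have -> : c == w.+1 by lia.
    by rewrite ?orbT.
  have Rc : R c by rewrite /R h.
  case/or3P: (nbr_right pw c1 h) => H.
  - have -> : P1 c by rewrite /P1 /p1 H; lia.
    by rewrite ?orbT.
  - have -> : G1 c by rewrite /G1 /g1 H prednK ?Rc; lia.
    by rewrite ?orbT.
  - have -> : G2 c by rewrite /G2 /g2 H !prednK ?Rc; lia.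
    by rewrite ?orbT.
have s1 : cnt (fun i => i == w.+1) = 1 by apply: cnt1; lia.
have s2 : cnt (fun i => i == w.-1) = 1 by apply: cnt1; lia.
by lia.
Qed.

(** * The joint neighbourhood of all pivots *)

Definition pivot_nbr c := has (fun w => pivot w && e w c) (iota 0 m.+1).

Let before c := has (fun w => [&& w < c, pivot w & e w c]) (iota 0 m.+1).
Let after c := has (fun w => [&& c < w, pivot w & e w c]) (iota 0 m.+1).
(** The exceptional neighbours, by position relative to the gap i they are charged to: i+1, i+2, i-1
    and i. *)
Let E1 c := [&& 0 < c, gap c.-1 & before c].
Let E2 c := [&& 1 < c, gap c.-2 & before c].
Let E3 c := gap c.+1 && after c.
Let E4 c := gap c && after c.

Lemma pivot_nbrP c : reflect (exists2 w, pivot w & e w c) (pivot_nbr c).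
Proof.
apply: (iffP hasP) => [[w _ /andP[]]|[w pw h]]; first by exists w.
exists w; last by rewrite pw.
by rewrite mem_iota /= add0n ltnS; apply: e_dom h.
Qed.

(** A neighbour that is not exceptional lies directly before or after some pivot, which gives at
    most 2p of them. *)
Lemma pivot_nbr_le_exc :
  cnt pivot_nbr <= 2 * p + (cnt E1 + cnt E2 + (cnt E3 + cnt E4)).
Proof.
have le1 : cnt (fun c => (0 < c) && pivot c.-1) <= p by apply: cnt_pred.
have le2 : cnt (fun c => pivot c.+1) <= p.
  by apply: cnt_succ; apply/negP=> /pivot_range[]; lia.
rewrite mul2n -addnn; apply: leq_trans (leq_add (leq_add le1 le2) (leqnn _)).
have U := cntU_le m.
apply: leq_trans (leq_add (U _ _) (leq_add (U _ _) (U _ _))).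
apply: leq_trans (leq_add (leqnn _) (U _ _)).
apply: leq_trans (U _ _).
apply: cnt_sub => c _ /pivot_nbrP[w pw h].
have wm : w \in iota 0 m.+1 by rewrite mem_iota /= add0n ltnS; apply: e_dom h.
have cw : c != w by apply: contraTneq h => ->; rewrite e_irr.
case: (ltngtP c w) cw => // cw _.
  have af : after c by apply/hasP; exists w; rewrite ?cw ?pw.
  have [c1|c1] := leqP w c.+1.
    have -> : pivot c.+1 by have -> : c.+1 = w by lia.
    by rewrite ?orbT.
  case/or3P: (nbr_left pw c1 h) => H.
  - by rewrite H ?orbT.
  - have -> : E3 c by rewrite /E3 H.
    by rewrite ?orbT.
  - have -> : E4 c by rewrite /E4 H.
    by rewrite ?orbT.
have be : before c by apply/hasP; exists w; rewrite ?cw ?pw.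
have c0 : 0 < c by lia.
have [c1|c1] := leqP c w.+1.
  by have -> : c.-1 = w by [lia]; rewrite pw c0.
case/or3P: (nbr_right pw c1 h) => H.
- by rewrite H c0.
- have -> : E1 c by rewrite /E1 H c0.
  by rewrite ?orbT.
- have -> : E2 c by rewrite /E2 H be andbT; lia.
  by rewrite ?orbT.
Qed.

Lemma exc_le : [/\ cnt E1 <= k, cnt E2 <= k, cnt E3 <= k & cnt E4 <= k].
Proof.
split.
- by apply: leq_trans (cnt_pred m gap); apply: cnt_sub => c _ /and3P[-> ->].
- by apply: leq_trans (cnt_pred2 gap); apply: cnt_sub => c _ /and3P[-> ->].
- apply: leq_trans (cnt_gap_succ (Q := gap) _) => //.
  by apply: cnt_sub => c _ /andP[].
- by apply: cnt_sub => c _ /andP[].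
Qed.

Lemma pivot_nbr_le : cnt pivot_nbr <= 2 * p + 4 * k.
Proof. by have := pivot_nbr_le_exc; have [] := exc_le; lia. Qed.

(** With a single gap, each of the four exceptional kinds has at most one member; all four together
    would need four pivots. *)
Lemma pivot_nbr_le_few : k <= 1 -> p <= 3 -> cnt pivot_nbr <= 2 * p + 3.
Proof.
move=> k1 p3; have := pivot_nbr_le_exc; have [] := exc_le.
suff : [|| cnt E1 == 0, cnt E2 == 0, cnt E3 == 0 | cnt E4 == 0] by lia.
apply: contraLR p3; rewrite -ltnNge !negb_or -!lt0n => /and4P[].
move=> /cnt_gt0[c1 _ /and3P[c1_gt0 g1 /hasP[w1 m1 /and3P[l1 p1 h1]]]].
move=> /cnt_gt0[c2 _ /and3P[c2_gt1 g2 /hasP[w2 m2 /and3P[l2 p2 h2]]]].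
move=> /cnt_gt0[c3 _ /andP[g3 /hasP[w3 m3 /and3P[l3 p3 h3]]]].
move=> /cnt_gt0[c4 _ /andP[g4 /hasP[w4 m4 /and3P[l4 p4 h4]]]].
have gap_inj i j : gap i -> gap j -> i = j.
  move=> gi gj; apply/eqP; apply: contraLR k1 => ij; rewrite -ltnNge.
  apply: (@cnt_uniq _ _ [:: i; j]); first by rewrite /= inE ij.
  move=> a; rewrite !inE => /orP[]/eqP->; rewrite ?gi ?gj andbT.
    by have /andP[/ltnW] := gi.
  by have /andP[/ltnW] := gj.
have E12 := gap_inj _ _ g4 g1; have E13 := gap_inj _ _ g4 g2.
have E14 := gap_inj _ _ g4 g3; move/gap_pivot: g4 => /andP[n4 n4'].
have neq u v : pivot u -> ~~ pivot v -> u != v.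
  by move=> pu; apply: contraNneq => <-.
(* If all four exceptional neighbours of the gap c4 occur, then the pivots
   w1, w2 < c4 < w3, w4 are distinct. *)
have w12 : w1 != w2.
  apply: contraTneq h2 => <-.
  have -> : c2 = c1.+1 by move: E12 E13 c1_gt0 c2_gt1; clear; lia.
  by apply: pivot_right.
have w34 : w3 != w4.
  apply: contraTneq h4 => <-.
  have -> : c4 = c3.+1 by move: E14; clear; lia.
  apply: pivot_left => //.
  by move: l3 (neq _ _ p3 n4) E14; clear; lia.
(* Neither c4 nor c4+1 is a pivot, which excludes the borderline positions. *)
have b1 : w1 < c4 by move: l1 (neq _ _ p1 n4) E12 c1_gt0; clear; lia.
have b2 : w2 < c4.
  by move: l2 (neq _ _ p2 n4) (neq _ _ p2 n4') E13 c2_gt1; clear; lia.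
have b3 : c4 < w3 by move: l3 (neq _ _ p3 n4) E14; clear; lia.
apply: (@cnt_uniq _ _ [:: w1; w2; w3; w4]).
  by rewrite /= !inE; move: w12 w34 b1 b2 b3 l4; clear; lia.
move=> a; rewrite !inE => H; suff : pivot a.
  by move=> pa; have [_] := pivot_range pa; rewrite pa; clear; lia.
by case/or4P: H => /eqP->.
Qed.

(** * Toughness against the counting bounds *)

Local Open Scope ring_scope.
Variables (R : realType) (t : R).
Hypothesis t_ge2 : 2 <= t.
Hypothesis m_gt0 : (0 < m)%N.
Hypothesis tough_e : colour_tough m e ((3 * t - 1) / 2).
Hypothesis degs : m.+1%:R - t <= (cnt (e 0%N) + cnt (e m))%:R.

(** Each index i < m is of exactly one kind: 0 ~ i+1, m ~ i, or a gap. *)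
Lemma cnt_XBgap : (cnt (fun i => e 0 i.+1) + cnt (e m) + k = m)%N.
Proof.
rewrite -cntU => [|i _]; last by apply/andP=> -[/not_succ/negbTE->].
rewrite -cntU => [|i _]; last by rewrite /gap; lia.
rewrite -[RHS](@cnt_ltn m m) //; apply: eq_bigr => i _; congr nat_of_bool.
rewrite /gap; have [/x_range|_] := boolP (e 0 i.+1); first by lia.
by have [/y_range|_] := boolP (e m i); lia.
Qed.

Lemma gap_le : k%:R <= t - 1.
Proof.
have x0 : (cnt (e 0%N) <= cnt (fun i => e 0 i.+1))%N.
  apply: leq_trans (cnt_pred m (fun i => e 0 i.+1)).
  by apply: cnt_sub => -[|i] _; rewrite ?e_irr.
have H : (cnt (e 0%N) + cnt (e m) + k <= m)%N by have := cnt_XBgap; lia.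
move: degs; rewrite -(ler_nat R) !natrD -natr1 in H *; lra.
Qed.

(** Deleting all neighbours of [J] isolates each of its vertices and keeps 0, so at least |J| + 1
    components remain. *)
Lemma nonadj_bound (J : pred nat) :
    (forall j, J j -> 0 < j <= m)%N ->
    (forall i j, J i -> J j -> ~~ e i j) -> (forall j, J j -> ~~ e 0 j) ->
    (0 < cnt J)%N ->
  (3 * t - 1) / 2 * (cnt J).+1%:R <=
    (cnt (fun c => has (fun w => J w && e w c) (iota 0 m.+1)))%:R.
Proof.
move=> J_range J_indep J_0 J_gt0.
pose I i := (i == 0%N) || J i.
have <- : cnt I = (cnt J).+1.
  by rewrite cntU ?cnt1 // => i _; apply/andP=> -[/eqP-> /J_range].
have hasP' w c : J w -> e w c -> has (fun w => J w && e w c) (iota 0 m.+1).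
  move=> Jw wc; apply/hasP; exists w; last by rewrite Jw.
  by rewrite mem_iota /= add0n ltnS; have /andP[] := J_range _ Jw.
(* Each vertex of [J] gets its own colour; all others, 0 included, share [None]. *)
apply: (tough_e (f := fun i => if J i then Some i else None)).
- move=> i _ Ii; apply/hasPn => w _; apply/andP=> -[Jw wi].
  case/orP: Ii => [/eqP i0|Ji]; last by move: wi; rewrite (negbTE (J_indep _ _ Jw Ji)).
  by move: wi; rewrite e_sym i0 (negbTE (J_0 _ Jw)).
- move=> i j ni nj ij; case: ifPn => [Ji|_]; first by rewrite (hasP' i) in nj.
  by case: ifPn => // Jj; rewrite (hasP' j) // e_sym in ni.
- move=> i j _ _; rewrite /I; case: ifPn => Ji; case: ifPn => Jj //.
    by move=> _ _ [].
  by rewrite !orbF => /eqP-> /eqP->.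
- rewrite cntU ?cnt1 // => i _; apply/andP=> -[/eqP-> /J_range] //.
Qed.

Lemma pivot_exists : (0 < p)%N.
Proof.
rewrite lt0n; apply/negP=> /eqP p0.
have nopivot i : ~~ pivot i.
  apply/negP=> pi; have [_ im] := pivot_range pi.
  suff : (0 < p)%N by rewrite p0.
  apply: (@cnt_uniq _ _ [:: i]) => // a; rewrite inE => /eqP->.
  by rewrite pi andbT; lia.
pose X i := e 0 i.+1; pose Y i := (0 < i)%N && e m i.-1.
(* The vertices of [Y] whose successor is missed by m, so that [YX_nonadj] does not apply to
   them. *)
pose bad i := [&& Y i, (i.+1 < m)%N & ~~ e m i.+1].
pose C i := ~~ (X i || Y i) || bad i.
have XY i : ~~ (X i && Y i) by have := nopivot i; rewrite /pivot /X /Y andbCA.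
(* If m misses i, a bad i is itself a gap; otherwise i+1 lies in [Y], hence not in [X], and is a
   gap. *)
have le_bad : (cnt bad <= 2 * k)%N.
  apply: (@leq_trans (k + cnt (fun i => gap i.+1))); last first.
    by have := @cnt_gap_succ gap (fun _ => id); lia.
  apply: leq_trans (cntU_le _ _ _); apply: cnt_sub => i _.
  move=> /and3P[/andP[i0 yi] im ni]; rewrite /gap im ni (ltnW im) /= !andbT.
  have := XY i; rewrite /X /Y i0 yi !andbT => -> /=.
  by have := XY i.+1; rewrite /X /Y /=; case: (e m i) => //=; rewrite andbT.
have le_B : (cnt (e m) <= cnt Y)%N.
  apply: (@cnt_succ _ Y); rewrite /Y /=; apply/negP=> h.
  by rewrite e_irr in h.
have total : (cnt X + cnt Y + cnt (fun i => ~~ (X i || Y i)) = m.+1)%N.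
  rewrite -cntU => [|i _]; last exact: XY.
  rewrite -cntU => [|i _]; last by rewrite andbN.
  rewrite -[RHS](@cnt_ltn m m.+1) // /cnt !big_nat.
  by apply: eq_bigr => i /= ->; rewrite orbN.
(* At most k + 1 vertices lie outside [X] and [Y], by [total], [cnt_XBgap] and [le_B]. *)
have le_C : (cnt C <= 3 * k + 1)%N.
  apply: leq_trans (cntU_le _ _ _) _.
  have := cnt_XBgap; rewrite -/X; lia.
pose I i := (i == 0%N) || (i == m).
have cI : cnt I = 2%N.
  by rewrite cntU ?cnt1 // => i _; apply/negP=> /andP[/eqP-> /eqP]; lia.
have X0 : X 0%N by apply: e_succ.
have Xm : ~~ X m by apply/negP=> /x_range; lia.
have Ym : Y m.
  rewrite /Y m_gt0 e_sym /=; have := @e_succ m.-1.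
  by rewrite prednK //; apply.
have nonadj i j : ~~ C j -> e i j -> X i -> X j.
  move=> nCj ij Xi; apply: contraNT nCj => nXj.
  rewrite /C (negbTE nXj) /=; case: (boolP (Y j)) => //= Yj.
  have [j0 yj] := andP Yj; have := x_range Xi => im.
  case: (ltngtP i j) => [lt_ij|lt_ji|eq_ij].
  - by move: ij; rewrite (negbTE (XY_nonadj lt_ij Xi yj)).
  - rewrite /bad Yj /=; apply/andP; split; first by apply: leq_ltn_trans im; apply: leqW.
    by apply: contraL ij => h; rewrite e_sym; apply: YX_nonadj.
  - by move: ij; rewrite eq_ij e_irr.
have : (3 * t - 1) / 2 * (cnt I)%:R <= (cnt C)%:R.
  apply: (tough_e (f := fun i => if X i then None else Some 0%N)).
  - by move=> i _ /orP[] /eqP->; rewrite /C ?X0 ?Ym ?orbT //= /bad; lia.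
  - move=> i j nCi nCj ij; suff -> : X i = X j by [].
    by apply/idP/idP; apply: nonadj; rewrite // e_sym.
  - by move=> i j _ _ /orP[] /eqP-> /orP[] /eqP-> //; rewrite X0 (negbTE Xm).
  - by rewrite cI.
(* Two components require 3t - 1 deleted vertices, but 3k + 1 <= 3t - 2. *)
by move: le_C gap_le; rewrite cI -(ler_nat R) natrD natrM; lra.
Qed.

Lemma tough_path_closes : False.
Proof.
have indep i j : pivot i -> pivot j -> ~~ e i j.
  move=> pi pj; have [_ xi yi] := and3P pi; have [_ xj yj] := and3P pj.
  case: (ltngtP i j) => [lt_ij|lt_ji|->]; last by rewrite e_irr.
    exact: XY_nonadj.
  by rewrite e_sym; apply: XY_nonadj.
have range j : pivot j -> (0 < j <= m)%N by move=> /pivot_range[]; lia.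
have nonadj0 j : pivot j -> ~~ e 0 j.
  move=> pj; have [j0 _] := pivot_range pj; have [_ xj yj] := and3P pj.
  by apply: contraL yj => h; apply: not_succ; rewrite prednK.
have [w _ pw] := cnt_gt0 pivot_exists.
have deg_w : 3 * t - 1 <= (p + 1 + k)%:R.
  have /andP[_ wm] := range _ pw.
  have : (3 * t - 1) / 2 * (cnt (pred1 w)).+1%:R <= (cnt (e w))%:R.
    apply: le_trans (nonadj_bound _ _ _ _) _; rewrite ?cnt1 //.
    - by move=> j /eqP->; apply: range.
    - by move=> i j /eqP-> /eqP->; rewrite e_irr.
    - by move=> j /eqP->; apply: nonadj0.
    - by rewrite ler_nat; apply: cnt_sub => c _ /hasP[v _ /andP[/eqP->]].
  move: (pivot_degree pw); rewrite cnt1 // -(ler_nat R); lra.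
have nbrs : (3 * t - 1) / 2 * p.+1%:R <= (cnt pivot_nbr)%:R.
  exact: nonadj_bound range indep nonadj0 pivot_exists.
have := gap_le; move: deg_w nbrs; rewrite !natrD -[p.+1%:R]natr1.
have [p4|p3] := leqP 4 p.
  have p4R : 4 <= p%:R :> R by rewrite (ler_nat R 4 p).
  have := pivot_nbr_le; rewrite -(ler_nat R) natrD !natrM.
  move: p4R t_ge2.
  move: (p%:R) (k%:R) ((cnt pivot_nbr)%:R) => P K M P4 t2 M_le _ M_ge K_le.
  (* The bounds give 3tP - 5t - 5P + 7 <= 0, and the left side equals 3(t - 2)(P - 4) + 7t + P - 17
     > 0. *)
  by have : 0 <= (t - 2) * (P - 4) by [rewrite mulr_ge0 ?subr_ge0]; nra.
move=> deg_w nbrs k_le.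
have p3R : p%:R <= 3 :> R by rewrite (ler_nat R p 3).
(* From p >= 3t - 2 - k >= 2t - 1 and p <= 3. *)
have [t2 k1R] : t = 2 /\ k%:R <= 1 :> R.
  by move: t_ge2 p3R deg_w k_le; move: (p%:R) (k%:R) => P K *; split; lra.
have k1 : (k <= 1)%N by rewrite -(ler_nat R).
(* Now p = 3: toughness requires 10 neighbours, and there are at most 9. *)
have := pivot_nbr_le_few k1 p3; rewrite -(ler_nat R) natrD natrM.
move: deg_w nbrs k1R; rewrite t2.
by move: (p%:R) (k%:R) ((cnt pivot_nbr)%:R) => P K M *; lra.
Qed.

End Crossings.

(** * From toughness and edge addition to a spanning path *)

Section HamiltonClosure.
Variable T : finType.
Implicit Types G H : sgraph T.

Definition colour_tough_graph (R : realType) (s : R) G :=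
  forall (C I : {set T}) (f : T -> option nat),
    I \subset ~: C ->
    (forall u v, u \notin C -> v \notin C -> G u v -> f u = f v) ->
    {in I &, injective f} -> (2 <= #|I|)%N ->
  s * #|I|%:R <= #|C|%:R.

(** The colour is constant on components of G - C, so the vertices of [I] lie in different ones and
    have distinct component roots. *)
Lemma tough_colour (R : realType) (s : R) G :
  0 <= s -> tough s G -> colour_tough_graph s G.
Proof.
move=> s_ge0 tG C I f IC f_edge f_inj I2.
pose H := induced G (~: C); pose V := {u | u \in ~: C}.
have H_sym : connect_sym H by apply/sym_connect_sym/adj_sym.
have f_connect (u v : V) : connect H u v -> f (val u) = f (val v).
  move=> /connectP[q]; elim: q u => [|w q IHq] u /=; first by move=> _ ->.
  case/andP=> uw wq ev; rewrite -(IHq w wq ev).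
  by apply: f_edge => //; [have := valP u | have := valP w]; rewrite inE.
pose J := [set u : V | val u \in I].
have cardJ : #|J| = #|I|.
  rewrite -(card_imset _ val_inj); apply: eq_card => u; apply/imsetP/idP.
    by move=> [v]; rewrite inE => vI ->.
  by move=> uI; exists (Sub u (subsetP IC u uI)); rewrite ?inE SubK.
have J_inj (u v : V) : u \in J -> v \in J -> connect H u v -> u = v.
  by rewrite !inE => uJ vJ /f_connect /(f_inj _ _ uJ vJ) /val_inj.
have cut : cutset G C.
  move: I2; rewrite -cardJ => /card_gt1P[u [v [uJ vJ uv]]].
  by exists u, v; apply: contra uv => /(J_inj _ _ uJ vJ)/eqP.
apply: le_trans (tG C cut); rewrite ler_wpM2l // ler_nat -cardJ.
rewrite -(@card_in_imset _ _ (fingraph.root H)); last first.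
  move=> u v uJ vJ uv; apply: J_inj => //.
  by rewrite -(root_connect H_sym) uv.
apply/subset_leq_card/subsetP=> _ /imsetP[u _ ->].
by rewrite !inE andbT; apply: roots_root.
Qed.

Lemma colour_tough_graph_sub (R : realType) (s : R) G H :
  subrel G H -> colour_tough_graph s G -> colour_tough_graph s H.
Proof.
move=> GH tG C I f IC f_edge; apply: tG => // u v uC vC /GH.
exact: f_edge.
Qed.

Lemma hamiltonian_sub G H : subrel G H -> hamiltonian G -> hamiltonian H.
Proof.
move=> GH [c [c3 /andP[cc uc] cT]]; exists c; split=> //.
by rewrite /ucycle uc andbT; apply: sub_cycle cc.
Qed.

(** Rotate the cycle to start at x. Only its first and last edges can be the new one, and dropping
    that edge leaves the path. *)
Lemma add_edge_path G x y (xy : x != y) :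
    hamiltonian (add_edge G xy) ->
  hamiltonian G \/ exists p, [/\ path G x p, last x p = y, uniq (x :: p)
                               & forall z, z \in x :: p].
Proof.
case=> c [c3 /andP[cc uc] cT].
have [i p rc] := rot_to (cT x).
have memp z : z \in x :: p by rewrite -rc mem_rot.
have up : uniq (x :: p) by rewrite -rc rot_uniq.
have size_p : (2 <= size p)%N by rewrite -ltnS -[(size p).+1]/(size (x :: p)) -rc size_rot.
have cp : cycle (add_edge G xy) (x :: p) by rewrite -rc rot_cycle.
have edge u v : u != x -> v != x -> add_edge G xy u v -> G u v.
  by move=> /negbTE ux /negbTE vx; rewrite /= /add_edge_rel ux vx /= andbF orbF.
have edgex u : u != x -> u != y -> add_edge G xy x u -> G x u.
  move=> /negbTE ux /negbTE uy.
  by rewrite /= /add_edge_rel ux uy !andbF !orbF.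
have [xp p_uniq] := andP up.
have path_sub u q : u != x -> x \notin q -> path (add_edge G xy) u q -> path G u q.
  elim: q u => //= v q IHq u ux; rewrite inE negb_or eq_sym.
  by move=> /andP[vx xq] /andP[uv vq]; rewrite (edge u v) // IHq.
case/lastP: p size_p xp p_uniq cp memp up {rc} => // p z.
case: p => [|a p] //= _ xazp azp_uniq; have [xa xz xp] : [/\ x != a, x != z & x \notin p].
  by move: xazp; rewrite inE mem_rcons inE !negb_or => /and3P[].
have az : a != z.
  by move: azp_uniq; rewrite mem_rcons inE negb_or -andbA => /andP[].
rewrite rcons_path last_rcons => /andP[xa' /andP[apz zx]] memp up.
have apz' : path G a (rcons p z).
  apply: path_sub apz; first by rewrite eq_sym.
  by rewrite mem_rcons inE negb_or xz.
have zxG : z != y -> G x z.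
  move=> zy; apply: edgex; rewrite 1?[z == x]eq_sym //.
  by rewrite adj_sym.
have [ay|ay] := eqVneq a y.
  (* The first edge xa may be new, so the cycle is traversed backwards from x. *)
  right; exists (rev (a :: rcons p z)).
  have revE : rev (a :: rcons p z) = z :: rev (belast a (rcons p z)).
    by rewrite lastI last_rcons rev_rcons.
  split.
  - rewrite revE /= zxG; last by rewrite -ay eq_sym.
    have := rev_path G a (rcons p z); rewrite last_rcons => ->.
    by rewrite (eq_path (e' := G)) // => u v; rewrite adj_sym.
  - by rewrite rev_cons last_rcons.
  - by move: up; rewrite /= mem_rev rev_uniq.
  - by move=> u; rewrite inE mem_rev -in_cons.
have xaG : G x a by apply: edgex; rewrite // eq_sym.
have [zy|zy] := eqVneq z y.
  by right; exists (a :: rcons p z); rewrite /= last_rcons xaG.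
left; exists (x :: a :: rcons p z); split=> //; first by rewrite /= size_rcons.
apply/andP; split=> //; rewrite /= rcons_path last_rcons xaG apz' /=.
by rewrite adj_sym zxG.
Qed.

(** * Renumbering the graph along a spanning path *)

Section SpanningPath.
Variables (G : sgraph T) (x : T) (q : seq T).
Hypotheses (xq_path : path G x q) (xq_uniq : uniq (x :: q)).
Hypothesis xq_all : forall z, z \in x :: q.

Let m := size q.
Let v i := nth x (x :: q) i.
Let ix z := index z (x :: q).
Let e i j := [&& (i <= m)%N, (j <= m)%N & G (v i) (v j)].

Let vK i : (i <= m)%N -> ix (v i) = i.
Proof. by move=> im; apply: index_uniq. Qed.

Let ixK z : v (ix z) = z.
Proof. exact: nth_index. Qed.

Let ix_le z : (ix z <= m)%N.
Proof. by have := xq_all z; rewrite -index_mem. Qed.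

Lemma card_cnt P : #|[set z | P (ix z)]| = cnt m P.
Proof.
rewrite -sum1dep_card big_mkcond -big_enum /=.
have -> : \sum_(z <- enum T) (if P (ix z) then 1 else 0)%N
    = \sum_(z <- x :: q) (if P (ix z) then 1 else 0)%N.
  apply/perm_big/uniq_perm; rewrite ?enum_uniq // => z.
  by rewrite mem_enum xq_all.
rewrite (big_nth x) /cnt !big_nat; apply: eq_bigr => i /= im.
by rewrite [ix _]vK //; case: (P i).
Qed.

Lemma deg_cnt i : (i <= m)%N -> deg G (v i) = cnt m (e i).
Proof.
move=> im; rewrite -card_cnt; apply: eq_card => z.
by rewrite !inE /e im ix_le ixK.
Qed.

(** A list of m + 1 entries covering all m + 1 vertices has no repetition. *)
Lemma index_order_ham l : (2 <= m)%N -> size l = m.+1 ->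
  (forall i, (i <= m)%N -> i \in l) -> cycle e l -> hamiltonian G.
Proof.
move=> m2 sl l_all cl; exists (map v l); split.
- by rewrite size_map sl.
- apply/andP; split.
    case: l cl {sl l_all} => //= a l; rewrite -map_rcons path_map.
    by apply: sub_path => i j /and3P[].
  apply: (@leq_size_uniq _ (x :: q)) => //.
    by move=> z _; rewrite -(ixK z); apply/map_f/l_all/ix_le.
  by rewrite size_map sl.
- by move=> z; rewrite -(ixK z); apply/map_f/l_all/ix_le.
Qed.

Lemma index_tough (R : realType) (s : R) :
  colour_tough_graph s G -> colour_tough m e s.
Proof.
move=> tG C I f IC f_edge f_inj I2; rewrite -!card_cnt.
apply: (tG _ _ (f \o ix)).
- by apply/subsetP=> z; rewrite !inE; apply/IC/ix_le.
- move=> u w; rewrite !inE => uC wC uw; apply: f_edge => //.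
  by rewrite /e !ix_le !ixK.
- move=> u w; rewrite !inE => uI wI /f_inj/= E.
  by rewrite -(ixK u) -(ixK w) E ?ix_le.
- by rewrite card_cnt.
Qed.

Lemma tough_spanning_path_ham (R : realType) (t : R) : 2 <= t -> (2 <= m)%N ->
    colour_tough_graph ((3 * t - 1) / 2) G ->
    #|T|%:R - t <= (deg G x + deg G (last x q))%:R ->
  hamiltonian G.
Proof.
move=> t2 m2 tG degs; apply: contrapT => nham.
have cardT : #|T| = m.+1.
  by rewrite cardT -(perm_size (uniq_perm xq_uniq (enum_uniq T) _)) // => z;
    rewrite mem_enum xq_all.
have dx : deg G x = cnt m (e 0%N) by rewrite -deg_cnt.
have dy : deg G (last x q) = cnt m (e m).
  by rewrite -deg_cnt // /v (_ : m = (size (x :: q)).-1) // nth_last.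
apply: (@tough_path_closes m e _ _ _ _ _ R t t2).
- by move=> i j; rewrite /e andbCA adj_sym.
- by move=> i; rewrite /e adj_irr !andbF.
- by move=> i j /and3P[].
- move=> i im; rewrite /e im (ltnW im); exact: (pathP x xq_path).
- by move=> l sl l_all; apply/negP => /(index_order_ham m2 sl l_all).
- exact: ltnW.
- exact: index_tough.
- by rewrite -cardT -dx -dy.
Qed.

End SpanningPath.

(** * Undoing the edges of the closure *)

Lemma add_edge_ham (R : realType) (t : R) G x y (xy : x != y) :
    2 <= t -> (3 <= #|T|)%N -> colour_tough_graph ((3 * t - 1) / 2) G ->
    #|T|%:R - t <= (deg G x + deg G y)%:R ->
  hamiltonian (add_edge G xy) -> hamiltonian G.
Proof.
move=> t2 T3 tG degs /add_edge_path[//|[q [xq lastq xq_uniq xq_all]]].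
apply: (tough_spanning_path_ham xq xq_uniq xq_all t2) => //; last by rewrite lastq.
rewrite -ltnS -[(size q).+1]/(size (x :: q)) -(card_uniqP xq_uniq).
by apply: leq_trans T3 _; apply/subset_leq_card/subsetP => z _; apply: xq_all.
Qed.

End HamiltonClosure.

Theorem lemma1p7 (R : realType) (t : R) (T : finType) (G Gs : sgraph T) :
  (3 <= #|T|)%N ->
  2 <= t ->
  tough ((3 * t - 1) / 2) G ->
  is_tclosure t G Gs ->
  (hamiltonian G <-> hamiltonian Gs).
Proof.
move=> T3 t2 tG clG; split; first exact/hamiltonian_sub/(tclosure_sup clG).
(* Toughness is put in its monotone form before the induction, which passes to larger and larger
   graphs. *)
have {tG} : colour_tough_graph ((3 * t - 1) / 2) G.
  by apply: tough_colour => //; lra.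
elim: clG T3 t2 => // {}G {}Gs x y xy [_ _ degs] _ IH T3 t2 tG /(IH T3 t2) ham.
apply: (add_edge_ham (xy := xy) t2 T3 tG degs); apply: ham.
by apply: colour_tough_graph_sub tG => u v Guv; rewrite /= /add_edge_rel Guv.
Qed.
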